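(* Let $(\Omega,\mathcal{A},\mu)$ be a complete finite measure space, let $\varphi$ be a Young function, let $\{\mathcal{A}_n\}_{n\in\mathbb{N}}$ be a sequence of $\sigma$-subalgebras of $\mathcal{A}$ and let $\mathfrak{D}$ be a $\sigma$-subalgebra of $\mathcal{A}$. Then the following hold. (a) If $\mathcal{A}_n\xrightarrow{\mu}\mathfrak{D}$ and $\varphi\in\Delta_2$, then for every $f\in L^{\varphi}(\mathfrak{D})$, $E(f\mid\mathcal{A}_n)\to E(f\mid\mathfrak{D})=f$ in the norm of $L^{\varphi}(\mathcal{A})$. (b) If for every $f\in L^{\varphi}(\mathfrak{D})$, $E(f\mid\mathcal{A}_n)\to E(f\mid\mathfrak{D})=f$ in the norm of $L^{\varphi}(\mathcal{A})$, then $\mathcal{A}_n\xrightarrow{\mu}\mathfrak{D}$.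
   Context: A Young function is a continuous convex function $\varphi:\mathbb{R}\to\mathbb{R}$ that is even, satisfies $\varphi(x)=0$ if and only if $x=0$, and satisfies $\lim_{x\to\infty}\varphi(x)/x=\infty$ and $\lim_{x\to\infty}\varphi(x)=\infty$. We write $\varphi\in\Delta_2$ if there are constants $k>0$, $x_0>0$ with $\varphi(2x)\le k\varphi(x)$ for all $x\ge x_0$. The Orlicz space $L^{\varphi}(\mathcal{A})=L^{\varphi}(\Omega,\mathcal{A},\mu)$ is the space of (a.e. classes of) real-valued $\mathcal{A}$-measurable $f$ with $\int_\Omega\varphi(\alpha f)\,d\mu<\infty$ for some $\alpha>0$, with norm $\|f\|_\varphi=N_\varphi(f)=\inf\{k>0:\int_\Omega\varphi(|f|/k)\,d\mu\le 1\}$; $L^{\varphi}(\mathfrak{D})=L^\varphi(\Omega,\mathfrak{D},\mu)$ is defined in the same way with $\mathfrak{D}$-measurable functions. For a $\sigma$-subalgebra $\mathfrak{D}\subseteq\mathcal{A}$, $E(f\mid\mathfrak{D})$ is the a.e. unique $\mathfrak{D}$-measurable function with $\int_D f\,d\mu=\int_D E(f\mid\mathfrak{D})\,d\mu$ for all $D\in\mathfrak{D}$. $\mathcal{A}_n\xrightarrow{\mu}\mathfrak{D}$ means that for every $D\in\mathfrak{D}$ there is a sequence $A_n\in\mathcal{A}_n$ with $\lim_n\mu(A_n\Delta D)=0$. *)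

(* Defs.v *)
From HB Require Import structures.
From mathcomp Require Import all_boot all_order all_algebra.
From mathcomp Require Import all_classical all_reals all_analysis measurable_realfun.

Set Implicit Arguments.
Unset Strict Implicit.
Unset Printing Implicit Defensive.

Import Order.TTheory GRing.Theory Num.Theory.
Import numFieldNormedType.Exports.

Local Open Scope classical_set_scope.
Local Open Scope ring_scope.

(* [convex_function] is stated for an lmodType, hence the [R^o]. *)
Record young_function (R : realType) (phi : R -> R) : Prop := {
  young_continuous : continuous phi ;
  young_convex : @convex_function R R^o setT phi ;
  young_even : forall x, phi (- x) = phi x ;
  young_eq0 : forall x, phi x = 0 <-> x = 0 ;
  young_superlinear : phi x / x @[x --> +oo] --> +oo ;
  young_cvgy : phi x @[x --> +oo] --> +oo }.

Definition Delta2 (R : realType) (phi : R -> R) : Prop :=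
  exists k x0 : R, [/\ 0 < k, 0 < x0 &
    forall x, x0 <= x -> phi (2 * x) <= k * phi x].

Section sub_sigma_algebras.
Context d (T : measurableType d) (R : realType).
Implicit Types (mu : {measure set T -> \bar R}) (G : set (set T)) (f : T -> R).

Definition is_sub_sigma_algebra G : Prop :=
  sigma_algebra setT G /\ G `<=` measurable.

(* [g_sigma_algebraType G] carries the sigma-algebra <<s G >>, which is G itself
   when G is already a sigma-algebra. *)
Definition measurable_wrt G f : Prop :=
  measurable_fun setT (f : g_sigma_algebraType G -> R).

Definition cvg_sigma mu (A : nat -> set (set T)) (D : set (set T)) : Prop :=
  forall B, D B -> exists A_ : nat -> set T,
    (forall n, A n (A_ n)) /\ mu (A_ n `+` B) @[n --> \oo] --> 0%E.

Definition is_cond_exp mu G f (g : T -> R) : Prop :=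
  measurable_wrt G g /\
  forall B, G B ->
    (\int[mu]_(x in B) (f x)%:E = \int[mu]_(x in B) (g x)%:E)%E.

(* A chosen version of E(f | G): versions exist for integrable f and agree
   a.e., see [cond_expP] and [is_cond_exp_ae_eq]. *)
Definition cond_exp mu G f : T -> R :=
  xget (cst 0) [set g | is_cond_exp mu G f g].

(* Elements are representatives; L^phi(Omega, calA, mu) is the case
   [G = measurable]. *)
Definition orlicz_space mu (phi : R -> R) G : set (T -> R) :=
  [set f | measurable_wrt G f /\
    exists2 alpha : R, 0 < alpha & (\int[mu]_x (phi (alpha * f x))%:E < +oo)%E].

(* Extended-real valued, so that the infimum is +oo rather than a junk real
   value when no k is admissible. *)
Definition luxemburg_norm mu (phi : R -> R) f : \bar R :=
  ereal_inf [set k%:E | k in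
    [set k : R | 0 < k /\ (\int[mu]_x (phi (`|f x| / k))%:E <= 1)%E]].

Definition orlicz_cvg mu (phi : R -> R) (u : nat -> T -> R) (g : T -> R) : Prop :=
  [/\ forall n, orlicz_space mu phi measurable (u n),
      orlicz_space mu phi measurable g &
      luxemburg_norm mu phi (u n \- g) @[n --> \oo] --> 0%E].

End sub_sigma_algebras.

Section cond_exp_theory.
Context d (T : measurableType d) (R : realType).
Variables (mu : {finite_measure set T -> \bar R}) (G : set (set T)).
Hypothesis sG : is_sub_sigma_algebra G.

Let S : measurableType _ := g_sigma_algebraType G.
Let iota : T -> S := idfun.

Let measurable_S (B : set T) : (measurable : set (set S)) B <-> G B.
Proof. by case: sG => sa _; rewrite /measurable/= sigma_algebra_id. Qed.

Let measurable_iota : measurable_fun setT iota.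
Proof.
by move=> _ B /measurable_S GB; rewrite setTI; case: sG => _; exact.
Qed.

(* The restriction of mu to G. *)
Definition restr_sigma : set (g_sigma_algebraType G) -> \bar R :=
  pushforward mu (idfun : T -> g_sigma_algebraType G).

Local Notation nu := restr_sigma.

Let m : {measure set S -> \bar R} :=
  measure_function_pushforward__canonical__measure_function_Measure mu
    measurable_iota.

HB.instance Definition _ := isMeasure.Build _ _ _ nu
  (measure0 m) (measure_ge0 m) (@measure_semi_sigma_additive _ _ _ m).

Let nu_fin : fin_num_fun nu.
Proof. by move=> B /measurable_S GB; apply: fin_num_measure; apply: sG.2. Qed.

HB.instance Definition _ := Measure_isFinite.Build _ _ _ nu nu_fin.

Let integral_nu (h : S -> \bar R) (B : set T) :
  measurable_fun setT h -> G B ->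
  (\int[nu]_(x in B) h x = \int[mu]_(x in B) h (iota x))%E.
Proof.
move=> mh /measurable_S GB; rewrite integralE [RHS]integralE.
have e (k : S -> \bar R) : measurable_fun setT k -> (forall x, 0 <= k x)%E ->
    (\int[nu]_(x in B) k x = \int[mu]_(x in B) k (iota x))%E.
  move=> mk k0; rewrite (ge0_integral_pushforward measurable_iota)//.
  exact: measurable_funS mk.
rewrite !e//; [exact: measurable_funeneg|exact: measurable_funepos].
Qed.

Lemma ex_cond_exp (f : T -> R) : mu.-integrable setT (EFin \o f) ->
  exists2 g, is_cond_exp mu G f g & nu.-integrable setT (EFin \o g).
Proof.
move=> fi.
pose c := measure_function_pushforward__canonical__charge_Charge
  (induced_charge fi) measurable_iota.
have cm : c `<< nu.
  apply/null_content_dominatesP => B /measurable_S GB nuB.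
  have mB : (measurable : set (set T)) B by exact: sG.2.
  apply: null_set_integral => //.
  exact/measurable_funTS/(measurable_int _ fi).
pose h := Radon_Nikodym c nu.
have hi : nu.-integrable setT h by exact: Radon_Nikodym_integrable.
have hE : EFin \o (fine \o h) = h.
  by apply/funext => x /=; rewrite fineK// Radon_Nikodym_fin_num.
have mh : measurable_fun setT h by exact: measurable_int hi.
exists (fine \o h); last by rewrite hE.
split; first exact: measurableT_comp.
move=> B GB; have mB : (measurable : set (set S)) B by exact/measurable_S.
transitivity (c B) => //.
rewrite (Radon_Nikodym_integral cm)// integral_nu//.
by apply: eq_integral => x _; rewrite -[LHS]fineK ?Radon_Nikodym_fin_num.
Qed.

Lemma cond_expP (f : T -> R) : mu.-integrable setT (EFin \o f) ->
  is_cond_exp mu G f (cond_exp mu G f).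
Proof.
move=> /ex_cond_exp[g fg _]; rewrite /cond_exp.
by case: xgetP => [h _ //|none]; case: (none g).
Qed.

Lemma is_cond_exp_ae_eq (f g h : T -> R) : mu.-integrable setT (EFin \o f) ->
  is_cond_exp mu G f g -> is_cond_exp mu G f h -> {ae mu, forall x, g x = h x}.
Proof.
move=> /ex_cond_exp[k [mk fk] ki].
suff e l : is_cond_exp mu G f l -> {ae mu, forall x, k x = l x}.
  move=> /e kg /e kh; apply: filterS2 kg kh => x <- //.
move=> [ml fl].
have : ae_eq nu setT (EFin \o k) (EFin \o l).
  apply: integral_ae_eq => //; first exact/measurable_EFinP.
  move=> E _ /measurable_S GE.
  by rewrite !integral_nu ?(=^~fk, =^~fl)//; exact/measurable_EFinP.
move=> [N [/measurable_S GN nuN0 kN]]; exists N; split => //.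
  exact: sG.2.
by move=> x /= nkl; apply: kN => /= kl; apply: nkl; have [] := kl I.
Qed.

End cond_exp_theory.

(* Main.v *)
Require Import Defs.
From mathcomp Require Import all_boot all_order all_algebra.
From mathcomp Require Import all_classical all_reals all_analysis measurable_realfun.
From mathcomp Require Import ring lra.

(* (a) Call f approximable if for all c and delta > 0, eventually some
   A_n-measurable h has modular int phi(c(f - h)) <= delta.  By hypothesis
   indicators of sets of D are approximable; convexity and dominated convergence
   extend this to every f in L^phi(D), since Delta_2 makes int phi(c f) finite
   for all c.  Writing E(f | A_n) - f = E(f - h | A_n) + (h - f), the conditional
   Jensen inequality bounds the modular of the first term by that of f - h.
   Jensen itself is obtained by writing phi as a countable supremum of affine
   functions, which commute with conditional expectation.
   (b) For B in D the sets A_n = {E(1_B | A_n) > 1/2} work: on the symmetric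
   difference of A_n and B the functions E(1_B | A_n) and 1_B differ by at least
   1/2, so Chebyshev applies. *)

Set Implicit Arguments.
Unset Strict Implicit.
Unset Printing Implicit Defensive.

Import Order.TTheory GRing.Theory Num.Theory.
Import numFieldNormedType.Exports.

Local Open Scope classical_set_scope.
Local Open Scope ring_scope.

(** * Convex functions on the line as suprema of countably many affine functions *)

Definition convex_ineq (R : realType) (psi : R -> R) : Prop :=
  forall t x y, 0 <= t <= 1 ->
    psi (t * x + (1 - t) * y) <= t * psi x + (1 - t) * psi y.

Section convex_real.
Context (R : realType) (psi : R -> R).
Hypothesis cpsi : convex_ineq psi.

(** With [t = (z - x) / (z - y)] one has [x = t * y + (1 - t) * z]; convexity at this point,
    multiplied by [z - y], is the three-slope inequality. *)
Lemma convex_ineq_slope y x z : y < x -> x < z ->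
  (psi x - psi y) / (x - y) <= (psi z - psi x) / (z - x).
Proof.
move=> yx xz.
have t01 : 0 <= (z - x) / (z - y) <= 1.
  by rewrite divr_ge0 ?ler_pdivrMr ?mul1r/=; lra.
have /= := cpsi y z t01.
set t := (z - x) / (z - y).
have tE : t * (z - y) = z - x by rewrite /t divfK//; apply/eqP; lra.
have -> : t * y + (1 - t) * z = x by lra.
move=> h; rewrite ler_pdivrMr ?subr_gt0// mulrAC ler_pdivlMr ?subr_gt0//.
have zy : 0 < z - y by lra.
have := ler_wpM2l (ltW zy) h.
have -> : (z - y) * (t * psi y + (1 - t) * psi z) =
  (t * (z - y)) * psi y + (z - y - t * (z - y)) * psi z by ring.
by rewrite tE; nra.
Qed.

(** The slope is the left derivative at [x], the supremum of the chord slopes from the left; every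
    chord slope to the right bounds these from above. *)
Lemma convex_ineq_support x : exists s, forall y, psi x + s * (y - x) <= psi y.
Proof.
pose S := [set (psi x - psi y) / (x - y) | y in [set y | y < x]].
have S0 : S !=set0.
  by exists ((psi x - psi (x - 1)) / (x - (x - 1))), (x - 1) => //=; lra.
have Sub z : x < z -> ubound S ((psi z - psi x) / (z - x)).
  by move=> xz _ [y /= yx <-]; exact: convex_ineq_slope.
have Sup : has_sup S.
  split => //; exists ((psi (x + 1) - psi x) / (x + 1 - x)).
  by apply: Sub; lra.
exists (sup S) => y; have [yx|xy|->] := ltgtP y x.
- have : (psi x - psi y) / (x - y) <= sup S.
    by apply: ub_le_sup => //; [exact: Sup.2|exists y].
  by rewrite ler_pdivrMr ?subr_gt0//; lra.
- have : sup S <= (psi y - psi x) / (y - x).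
    by apply: ge_sup => //; exact: Sub.
  by rewrite ler_pdivlMr ?subr_gt0//; lra.
- by rewrite subrr mulr0 addr0.
Qed.

(* The supporting lines at rational points suffice, because their slopes stay
   bounded near [x]. *)
Lemma convex_ineq_countable_envelope : continuous psi -> exists a b : nat -> R,
  (forall n x, a n * x + b n <= psi x) /\
  (forall x e, 0 < e -> exists n, psi x - e < a n * x + b n).
Proof.
move=> ctspsi.
have [s sP] := choice convex_ineq_support.
(* Enumerates the rationals; codes that decode to nothing are sent to 0. *)
pose r n : R := ratr (odflt 0 (unpickle n : option rat)).
exists (fun n => s (r n)), (fun n => psi (r n) - s (r n) * r n); split.
  by move=> n x; have := sP (r n) x; lra.
move=> x e e0.
pose K := `|s (x + 1)| + 1.
have K0 : 0 < K by rewrite /K ltr_wpDl.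
have /cvgrPdist_lt/(_ (e / 2)) := ctspsi x.
rewrite divr_gt0//= => /(_ isT)/nbhs_ballP[d /= d0 xd].
(* For a rational [q] in []x, x + u[], the bound [d] controls [psi q], the bound 1 keeps [q] below
   [x + 1], and the last one keeps [K * (q - x)] below [e / 2]. *)
pose u := Num.min d (Num.min 1 (e / (2 * K))).
have u0 : 0 < u by rewrite /u !lt_min d0 ltr01 divr_gt0// mulr_gt0.
have ud : u <= d by rewrite /u ge_min lexx.
have u1 : u <= 1 by rewrite /u !ge_min lexx orbT.
have ue : u * K <= e / 2.
  by rewrite -ler_pdivlMr// -mulrA -invfM /u !ge_min lexx !orbT.
have [q] := @rat_in_itvoo R x (x + u) ltac:(lra).
rewrite in_itv/= => /andP[xq qu].
exists (pickle q); rewrite /r pickleK/=.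
have := xd (ratr q).
rewrite /ball/= distrC ger0_norm; last lra.
move=> /(_ ltac:(lra)) /ltr_normlP[_ psiq].
(* Adding these two support inequalities shows that the slopes are monotone, so
   [s (ratr q) <= s (x + 1) < K]. *)
have h1 := sP (ratr q) (x + 1).
have h2 := sP (x + 1) (ratr q).
have sK : s (ratr q) < K.
  have : s (ratr q) <= s (x + 1) by nra.
  by have := ler_norm (s (x + 1)); rewrite /K; lra.
suff : s (ratr q) * (ratr q - x) < e / 2 by lra.
have : s (ratr q) * (ratr q - x) < K * (ratr q - x) by rewrite ltr_pM2r//; lra.
have : K * (ratr q - x) <= K * u by rewrite ler_pM2l//; lra.
by lra.
Qed.

End convex_real.

(** * Conditional expectation: integrability, affine maps and Jensen's inequality *)

Section sub_sigma_algebra_theory.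
Context d (T : measurableType d) (R : realType).
Variables (mu : {finite_measure set T -> \bar R}) (G : set (set T)).
Hypothesis sG : is_sub_sigma_algebra G.

Lemma sub_sigma_algebra_measurableE (B : set T) :
  (measurable : set (set (g_sigma_algebraType G))) B = G B.
Proof. by case: sG => sa _; rewrite /measurable/= sigma_algebra_id. Qed.

Lemma measurable_wrt_preimage (f : T -> R) (Y : set R) :
  measurable_wrt G f -> measurable Y -> G (f @^-1` Y).
Proof.
move=> mf mY; rewrite -sub_sigma_algebra_measurableE -[X in measurable X]setTI.
by apply: mf => //; rewrite sub_sigma_algebra_measurableE; exact: sG.1.
Qed.

Lemma measurable_wrtW (f : T -> R) : measurable_wrt G f -> measurable_fun setT f.
Proof.
by move=> mf _ Y mY; rewrite setTI; apply/sG.2/measurable_wrt_preimage.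
Qed.

(** [is_cond_exp] only equates integrals. Since [{k >= 0}] and its complement lie in [G], the
    integral of [|k|] over each is, up to sign, that of [f], hence finite. *)
Lemma is_cond_exp_integrable (f k : T -> R) :
  mu.-integrable setT (EFin \o f) -> is_cond_exp mu G f k ->
  mu.-integrable setT (EFin \o k).
Proof.
move=> fi [mk fk].
have mkT := measurable_wrtW mk.
apply/integrableP; split; first exact/measurable_EFinP.
pose P := k @^-1` `[0, +oo[.
have GP : G P by exact: measurable_wrt_preimage.
have GPC : G (~` P).
  rewrite -sub_sigma_algebra_measurableE; apply: measurableC.
  by rewrite sub_sigma_algebra_measurableE.
have mP := sG.2 _ GP; have mPC := sG.2 _ GPC.
have fin B : G B -> (\int[mu]_(x in B) (f x)%:E \is a fin_num)%E.
  move=> GB; apply: integrable_fin_num => //; first exact: sG.2.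
  by apply: integrableS fi => //; exact: sG.2.
have mabs : measurable_fun setT (fun x => `|(EFin \o k) x|)%E.
  by apply: measurableT_comp => //; exact/measurable_EFinP.
rewrite -(setUv P) ge0_integral_setU//; last 2 first.
- by rewrite setUv.
- by apply/disj_setPCl.
apply: lte_add_pinfty.
- rewrite (_ : (\int[mu]_(x in P) _)%E = (\int[mu]_(x in P) (f x)%:E)%E).
    by rewrite ltey_eq fin.
  rewrite fk//; apply: eq_integral => x; rewrite inE/P/= in_itv/= andbT => k0.
  by rewrite ger0_norm.
- rewrite (_ : (\int[mu]_(x in ~` P) _)%E = (- \int[mu]_(x in ~` P) (f x)%:E)%E).
    by rewrite ltey_eq fin_numN fin.
  rewrite fk//.
  have k0 x : (~` P) x -> k x <= 0.
    by rewrite /P/= in_itv/= andbT => /negP; rewrite -ltNge => /ltW.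
  rewrite -[LHS]oppeK; congr oppe; rewrite -integral_ge0N//.
  apply: eq_integral => x; rewrite inE => /k0 kx /=.
  by rewrite ler0_norm// opprK.
Qed.

Lemma integrable_affine (f : T -> R) (a b : R) :
  mu.-integrable setT (EFin \o f) ->
  mu.-integrable setT (fun x => (a * f x + b)%:E).
Proof.
move=> fi; apply: (eq_integrable _ (fun x => a%:E * (f x)%:E + b%:E)%E) => //.
apply: integrableD => //; last exact: finite_measure_integrable_cst.
exact: integrableZl.
Qed.

Lemma is_cond_exp_affine (f k : T -> R) (a b : R) :
  mu.-integrable setT (EFin \o f) -> is_cond_exp mu G f k ->
  is_cond_exp mu G (fun x => a * f x + b) (fun x => a * k x + b).
Proof.
move=> fi fk; have ki := is_cond_exp_integrable fi fk; case: fk => mk fk; split.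
  by apply: measurable_funD => //; exact: measurable_funM.
move=> B GB; have mB := sG.2 _ GB.
have aux (h : T -> R) : mu.-integrable setT (EFin \o h) ->
    (\int[mu]_(x in B) (a * h x + b)%:E =
     a%:E * \int[mu]_(x in B) (h x)%:E + \int[mu]_(x in B) b%:E)%E.
  move=> hi; have hBi : mu.-integrable B (EFin \o h) by exact: integrableS hi.
  under eq_integral do rewrite EFinD EFinM.
  rewrite integralD//; last exact: finite_measure_integrable_cst.
  - by rewrite integralZl.
  - exact: integrableZl.
by rewrite !aux// fk.
Qed.

Lemma is_cond_expB (f k h : T -> R) :
  mu.-integrable setT (EFin \o f) -> mu.-integrable setT (EFin \o h) ->
  measurable_wrt G h -> is_cond_exp mu G f k ->
  is_cond_exp mu G (f \- h) (k \- h).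
Proof.
move=> fi hi mh fk; have ki := is_cond_exp_integrable fi fk.
case: fk => mk fk; split; first exact: measurable_funB.
move=> B GB; have mB := sG.2 _ GB.
have BT (g : T -> R) : mu.-integrable setT (EFin \o g) -> mu.-integrable B (EFin \o g).
  by move=> gi; apply: integrableS gi.
under eq_integral do rewrite EFinB.
under [RHS]eq_integral do rewrite EFinB.
by rewrite !integralB_EFin ?fk//; exact: BT.
Qed.

(** The running maxima [m n] of affine minorants increase to [psi]. Induction on [n] bounds the
    integral of [m n \o k] over each set of [G] by that of [psi \o f], and monotone convergence
    concludes. *)
Lemma cond_jensen (psi : R -> R) (f k : T -> R) :
  convex_ineq psi -> continuous psi -> (forall x, 0 <= psi x) ->
  mu.-integrable setT (EFin \o f) -> is_cond_exp mu G f k ->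
  (\int[mu]_x (psi (k x))%:E <= \int[mu]_x (psi (f x))%:E)%E.
Proof.
move=> cpsi ctspsi psi0 fi fk.
have mpsi : measurable_fun setT psi by exact: continuous_measurable_fun.
have mf : measurable_fun setT f by apply/measurable_EFinP; exact: measurable_int fi.
have mk := fk.1.
have mkT := measurable_wrtW mk.
have ki := is_cond_exp_integrable fi fk.
have [a [b [le_psi near_psi]]] := convex_ineq_countable_envelope cpsi ctspsi.
pose l n x := a n * x + b n.
(* Starting at 0 makes every [m n] nonnegative, as monotone convergence requires, while staying
   below [psi]. *)
pose m := fix m n x := if n is n'.+1 then Num.max (m n' x) (l n' x) else 0.
have ml n : measurable_fun setT (l n).
  by apply: measurable_funD => //; exact: measurable_funM.
have mm n : measurable_fun setT (m n).
  by elim: n => [|n IH] /=; [exact: measurable_cst|exact: measurable_maxr].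
have m0 n x : 0 <= m n x by elim: n => //= n IH; rewrite le_max IH.
have mpsile n x : m n x <= psi x by elim: n => //= n IH; rewrite ge_max IH le_psi.
have mS x : {homo m^~ x : n p / (n <= p)%N >-> n <= p}.
  by apply/nondecreasing_seqP => n /=; rewrite le_max lexx.
have lint n B : G B ->
    (\int[mu]_(x in B) (l n (k x))%:E <= \int[mu]_(x in B) (psi (f x))%:E)%E.
  move=> GB; have mB := sG.2 _ GB.
  rewrite -(is_cond_exp_affine (a n) (b n) fi fk).2//.
  (* An infinite right side is trivial; otherwise [psi \o f] is integrable on [B] and the integrals
     can be compared. *)
  have [psify|] := ltP (\int[mu]_(x in B) (psi (f x))%:E)%E +oo%E; last first.
    by rewrite leye_eq => /eqP ->; rewrite leey.
  apply: le_integral => //.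
  - apply: (integrableS measurableT mB (@subsetT _ _)).
    exact: integrable_affine.
  - apply/integrableP; split.
      by apply/measurable_EFinP/measurable_funTS; exact: measurableT_comp.
    under eq_integral do rewrite gee0_abs ?lee_fin//.
    exact: psify.
  - by move=> x _; rewrite lee_fin le_psi.
(* All [B] in [G] are needed at once: [B] is cut along the set [C] where the new affine function
   reaches the old maximum. [lint] serves inside [C], the induction hypothesis outside. *)
have mint n : forall B, G B ->
    (\int[mu]_(x in B) (m n (k x))%:E <= \int[mu]_(x in B) (psi (f x))%:E)%E.
  elim: n => [|n IH] B GB; have mB := sG.2 _ GB.
    by rewrite /= integral0 integral_ge0// => x _; rewrite lee_fin.
  pose C := (fun x => l n (k x) - m n (k x)) @^-1` `[0, +oo[.
  have GC : G C.
    apply: measurable_wrt_preimage => //; apply: measurable_funB.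
      exact: (measurableT_comp (ml n) mk).
    exact: (measurableT_comp (mm n) mk).
  have GBC : G (B `&` C).
    rewrite -sub_sigma_algebra_measurableE.
    by apply: measurableI; rewrite sub_sigma_algebra_measurableE.
  have GBD : G (B `\` C).
    rewrite -sub_sigma_algebra_measurableE.
    by apply: measurableD; rewrite sub_sigma_algebra_measurableE.
  have disj : [disjoint B `&` C & B `\` C].
    by apply/disj_set2P; rewrite setDE setIACA setICr setI0.
  have mmk p : measurable_fun setT (fun x => (m p (k x))%:E).
    by apply/measurable_EFinP; exact: measurableT_comp (mm p) mkT.
  have mpsif : measurable_fun setT (fun x => (psi (f x))%:E).
    by apply/measurable_EFinP; exact: measurableT_comp.
  rewrite -(setUIDK B C) [leRHS]ge0_integral_setU//; last 4 first.
  - exact: sG.2.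
  - exact: sG.2.
  - exact: measurable_funTS.
  - by move=> x _; rewrite lee_fin.
  rewrite ge0_integral_setU//; last 4 first.
  - exact: sG.2.
  - exact: sG.2.
  - exact/measurable_funTS/(mmk n.+1).
  - by move=> x _; rewrite lee_fin (m0 n.+1).
  apply: leeD.
  - apply: le_trans (lint n _ GBC); rewrite le_eqVlt; apply/orP; left; apply/eqP.
    apply: eq_integral => x; rewrite inE => -[_]; rewrite /C/= in_itv/= andbT.
    by rewrite subr_ge0 => /max_r ->.
  - apply: le_trans (IH _ GBD); rewrite le_eqVlt; apply/orP; left; apply/eqP.
    apply: eq_integral => x; rewrite inE => -[_]; rewrite /C/= in_itv/= andbT.
    by move/negP; rewrite -ltNge subr_lt0 => /ltW/max_l ->.
have lim_m x : limn (fun n => (m n (k x))%:E) = (psi (k x))%:E.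
  apply/cvg_lim => //; apply/fine_cvgP; split; first exact: nearW.
  apply/cvgrPdist_lt => e e0; have [N psiN] := near_psi (k x) e e0.
  (* [m N.+1] is the first maximum that includes [l N]. *)
  exists N.+1 => //= n Nn; rewrite ger0_norm ?subr_ge0//.
  have : l N (k x) <= m n (k x).
    by apply: le_trans (mS _ _ _ Nn); rewrite /= le_max lexx orbT.
  by rewrite /l; lra.
have mcvg := @cvg_monotone_convergence _ _ _ mu setT measurableT
  (fun n x => (m n (k x))%:E).
under eq_integral do rewrite -lim_m.
apply: cvge_le (mcvg _ _ _).
- by apply: nearW => n; apply: mint; rewrite -sub_sigma_algebra_measurableE.
- by move=> n; apply/measurable_EFinP; exact: measurableT_comp (mm n) mkT.
- by move=> n x _; rewrite lee_fin.
- by move=> x _ n p np; rewrite lee_fin; exact: mS.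
Qed.

End sub_sigma_algebra_theory.

(** * Monotonicity and growth of Young functions *)

Section young_theory.
Context (R : realType) (phi : R -> R).
Hypothesis yphi : young_function phi.

(** Trades the interval-typed weights of [convex_function] for real weights with explicit bounds. *)
Lemma young_convex_ineq : convex_ineq phi.
Proof.
move=> t x y /andP[t0 t1].
have := young_convex yphi (Itv01 t0 t1) (in_setT x) (in_setT y).
by rewrite !convRE.
Qed.

Lemma young0 : phi 0 = 0.
Proof. exact/(young_eq0 yphi). Qed.

Lemma young_norm x : phi `|x| = phi x.
Proof. by have [x0|x0] := ger0P x; rewrite ?(young_even yphi). Qed.

(** The absolute value of [x] is a convex combination of plus and minus that of [y], two points
    where the even function [phi] takes the same value. *)
Lemma young_le_norm x y : `|x| <= `|y| -> phi x <= phi y.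
Proof.
move=> xy; rewrite -(young_norm x) -(young_norm y).
have [y0|y0] := eqVneq `|y| 0.
  by move: xy; rewrite y0 normr_le0 => /eqP ->; rewrite normr0.
have yp : 0 < `|y| by rewrite lt_def y0/=.
have t01 : 0 <= (`|y| + `|x|) / (2 * `|y|) <= 1.
  by rewrite divr_ge0 ?ler_pdivrMr/=; have := normr_ge0 x; lra.
have := young_convex_ineq `|y| (- `|y|) t01.
set t := (_ / _); have tE : t * (2 * `|y|) = `|y| + `|x|.
  by rewrite /t divfK// mulf_neq0// pnatr_eq0.
rewrite (young_even yphi) (_ : t * `|y| + _ = `|x|); last lra.
by rewrite (_ : _ + _ = phi `|y|)//; ring.
Qed.

Lemma young_ge0 x : 0 <= phi x.
Proof. by rewrite -young0; apply: young_le_norm; rewrite normr0. Qed.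

Lemma young_convex_ineqM c : convex_ineq (fun x => phi (c * x)).
Proof.
move=> t x y t01; rewrite mulrDr !(mulrCA c).
exact: young_convex_ineq.
Qed.

Lemma young_continuousM c : continuous (fun x : R => phi (c * x)).
Proof.
move=> x; apply: (@continuous_comp _ _ _ ( *%R c) phi); last exact: young_continuous.
exact: mulrl_continuous.
Qed.

Lemma young_add x y : phi (x + y) <= 2^-1 * phi (2 * x) + 2^-1 * phi (2 * y).
Proof.
have h : 0 <= (2^-1 : R) <= 1 by lra.
have := young_convex_ineq (2 * x) (2 * y) h.
have -> : 1 - 2^-1 = 2^-1 :> R by lra.
by rewrite !mulrA mulVf// !mul1r.
Qed.

Lemma young_measurable : measurable_fun setT phi.
Proof. exact: continuous_measurable_fun (young_continuous yphi). Qed.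

(** Superlinearity gives [phi x >= x] for large [x]; the constant absorbs the rest. This yields the
    inclusion of the Orlicz space in L^1. *)
Lemma young_linear_growth : exists M, forall x, `|x| <= M + phi x.
Proof.
have [M [_ phiM]] := (cvgryPge _).1 (young_superlinear yphi) 1.
exists (`|M| + 1) => x; have [xM|Mx] := leP `|x| (`|M| + 1).
  by have := young_ge0 x; lra.
have Mltx : M < `|x| by have := ler_norm M; lra.
have := phiM _ Mltx; rewrite ler_pdivlMr ?mul1r ?young_norm.
  by have := normr_ge0 M; lra.
by have := normr_ge0 M; lra.
Qed.

(** Removes the threshold [x0]: below it [phi (2 * x)] is at most [phi (2 * x0)], a constant that is
    integrable for a finite measure. *)
Lemma Delta2_growth : Delta2 phi ->
  exists k M, 0 < k /\ forall x, phi (2 * x) <= k * phi x + M.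
Proof.
move=> [k [x0 [k0 x00 kP]]]; exists k, (phi (2 * x0)); split=> // x.
have kx := mulr_ge0 (ltW k0) (young_ge0 x).
have px := young_ge0 (2 * x0).
have [x0x|xx0] := leP x0 `|x|.
  have := kP _ x0x; rewrite young_norm.
  by rewrite -[phi (2 * `|x|)]young_norm normrM normr_id -normrM young_norm; lra.
apply: ler_wpDl => //; apply: young_le_norm.
by rewrite !normrM ler_pM2l ?normr_gt0// (gtr0_norm x00) ltW.
Qed.

End young_theory.

(** * Estimates for the modular int phi(c f) over a finite measure *)

Section modular.
Context d (T : measurableType d) (R : realType).
Variables (mu : {finite_measure set T -> \bar R}) (phi : R -> R).
Hypothesis yphi : young_function phi.
Implicit Types f g u v : T -> R.

Lemma measurable_young_comp u :
  measurable_fun setT u -> measurable_fun setT (fun x => (phi (u x))%:E).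
Proof.
move=> mu_; apply/measurable_EFinP.
exact: measurableT_comp (young_measurable yphi) mu_.
Qed.

(** Replaces the triangle inequality for the modular: by midpoint convexity the bound [delta] is
    kept, at the price of doubling the arguments. *)
Lemma young_integral_add u v (delta : R) :
  measurable_fun setT u -> measurable_fun setT v ->
  (\int[mu]_x (phi (2 * u x))%:E <= delta%:E ->
   \int[mu]_x (phi (2 * v x))%:E <= delta%:E ->
   \int[mu]_x (phi (u x + v x))%:E <= delta%:E)%E.
Proof.
move=> mfu mfv ud vd.
have m2 (w : T -> R) : measurable_fun setT w ->
    measurable_fun setT (fun x => (phi (2 * w x))%:E).
  by move=> mw; apply: measurable_young_comp; exact: measurable_funM.
have phi0 (w : T -> R) x : setT x -> (0 <= (phi (2 * w x))%:E)%E.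
  by rewrite lee_fin young_ge0.
have h0 : 0 <= 2^-1 :> R by lra.
apply: (@le_trans _ _ (\int[mu]_x ((2^-1)%:E * (phi (2 * u x))%:E +
    (2^-1)%:E * (phi (2 * v x))%:E))%E).
  apply: ge0_le_integral => //.
  - by move=> x _; rewrite lee_fin young_ge0.
  - by apply: measurable_young_comp; exact: measurable_funD.
  - by apply: emeasurable_funD; apply: measurable_funeM; exact: m2.
  - by move=> x _; rewrite -!EFinM -EFinD lee_fin; exact: young_add.
rewrite ge0_integralD//; last 4 first.
- by move=> x xT; rewrite mule_ge0 ?phi0// lee_fin.
- by apply: measurable_funeM; exact: m2.
- by move=> x xT; rewrite mule_ge0 ?phi0// lee_fin.
- by apply: measurable_funeM; exact: m2.
rewrite !ge0_integralZl_EFin//; [|exact: phi0|exact: m2|exact: phi0|exact: m2].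
have -> : delta%:E = ((2^-1)%:E * delta%:E + (2^-1)%:E * delta%:E)%E.
  by rewrite -EFinM -EFinD; congr (_%:E); lra.
by apply: leeD; rewrite lee_pmul2l ?lte_fin//; lra.
Qed.

Lemma young_integral_le u v : measurable_fun setT u -> measurable_fun setT v ->
  (forall x, `|u x| <= `|v x|) ->
  (\int[mu]_x (phi (u x))%:E <= \int[mu]_x (phi (v x))%:E)%E.
Proof.
move=> mfu mfv uv; apply: ge0_le_integral => //.
- by move=> x _; rewrite lee_fin young_ge0.
- exact: measurable_young_comp.
- exact: measurable_young_comp.
- by move=> x _; rewrite lee_fin young_le_norm.
Qed.

Lemma young_integrable u : measurable_fun setT u ->
  (\int[mu]_x (phi (u x))%:E < +oo)%E ->
  mu.-integrable setT (fun x => (phi (u x))%:E).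
Proof.
move=> mfu uy; apply/integrableP; split; first exact: measurable_young_comp.
by under eq_integral do rewrite gee0_abs ?lee_fin ?young_ge0//.
Qed.

Lemma modular_integrable f (c : R) : 0 < c -> measurable_fun setT f ->
  (\int[mu]_x (phi (c * f x))%:E < +oo)%E -> mu.-integrable setT (EFin \o f).
Proof.
move=> c0 mf fy; have [M phiM] := young_linear_growth yphi.
have M0 : 0 <= M by have := phiM 0; rewrite normr0 (young0 yphi) addr0.
have cphi : mu.-integrable setT
    (fun x => ((c^-1 * M)%:E + c^-1%:E * (phi (c * f x))%:E)%E).
  apply: integrableD => //; first exact: finite_measure_integrable_cst.
  by apply: integrableZl => //; apply: young_integrable => //; exact: measurable_funM.
apply: le_integrable cphi => //; first exact/measurable_EFinP.
move=> x _; rewrite /= lee_fin.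
apply: le_trans (ler_norm _); rewrite -mulrDr -ler_pdivrMl ?invr_gt0// invrK.
by apply: le_trans (phiM _); rewrite normrM gtr0_norm.
Qed.

(** Iterating the growth bound makes the modular of [2 ^+ m * a * f] finite for every [m], and some
    [2 ^+ m * a] exceeds the absolute value of [c]. *)
Lemma Delta2_modular_lty f (a : R) : Delta2 phi -> 0 < a ->
  measurable_fun setT f -> (\int[mu]_x (phi (a * f x))%:E < +oo)%E ->
  forall c, (\int[mu]_x (phi (c * f x))%:E < +oo)%E.
Proof.
move=> /(Delta2_growth yphi)[k [M [k0 phi2]]] a0 mf fy c.
have mc b : measurable_fun setT (fun x => b * f x : R) by exact: measurable_funM.
have pow m : (\int[mu]_x (phi (2 ^+ m * a * f x))%:E < +oo)%E.
  elim: m => [|m IH]; first by under eq_integral do rewrite expr0 mul1r.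
  have i : mu.-integrable setT (fun x => (k%:E * (phi (2 ^+ m * a * f x))%:E + M%:E)%E).
    apply: integrableD => //; last exact: finite_measure_integrable_cst.
    by apply: integrableZl => //; apply: young_integrable.
  have : mu.-integrable setT (fun x => (phi (2 ^+ m.+1 * a * f x))%:E).
    apply: le_integrable i => //; first exact: measurable_young_comp.
    move=> x _; rewrite /= lee_fin ger0_norm ?young_ge0//.
    by apply: le_trans (ler_norm _); rewrite exprS -!mulrA; exact: phi2.
  by move=> /integrable_lty; apply.
have [m cm] : exists m, `|c| <= 2 ^+ m * a.
  exists (Num.bound (`|c| / a)); rewrite -ler_pdivrMr//.
  exact/ltW/upper_nthrootP.
apply: le_lt_trans (pow m); apply: young_integral_le => // x.
by rewrite !normrM ler_wpM2r// -normrM (le_trans cm)// ler_norm.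
Qed.

End modular.

(** * Modular approximation of functions in L^phi(D) by A_n-measurable functions *)

Section approximation.
Import HBNNSimple.
Context d (T : measurableType d) (R : realType).
Variables (mu : {finite_measure set T -> \bar R}) (phi : R -> R).
Variable A : nat -> set (set T).
Implicit Types f g : T -> R.
Hypothesis yphi : young_function phi.
Hypothesis sA : forall n, is_sub_sigma_algebra (A n).

(** Quantifying over all dilations [c] gives stability under sums and multiples, where [c] becomes
    [2 * c] or [c * a], and later gives norm convergence. *)
Definition modular_approximable (f : T -> R) : Prop :=
  measurable_fun setT f /\
  forall c delta : R, 0 < delta -> \forall n \near \oo,
    exists2 h, measurable_wrt (A n) h &
      (\int[mu]_x (phi (c * (f x - h x)))%:E <= delta%:E)%E.

Lemma modular_approximable_cst0 : modular_approximable (cst 0).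
Proof.
split=> // c delta delta0; apply: nearW => n; exists (cst 0).
  exact: measurable_cst.
under eq_integral do rewrite subrr mulr0 (young0 yphi).
by rewrite integral0 lee_fin ltW.
Qed.

Lemma modular_approximableD f g : modular_approximable f ->
  modular_approximable g -> modular_approximable (f \+ g).
Proof.
move=> [mf apf] [mg apg]; split; first exact: measurable_funD.
move=> c delta delta0.
apply: filterS2 (apf (2 * c) delta delta0) (apg (2 * c) delta delta0).
move=> n [h mh hf] [k mk kg]; exists (h \+ k); first exact: measurable_funD.
have mhT := measurable_wrtW (sA n) mh; have mkT := measurable_wrtW (sA n) mk.
under eq_integral do rewrite opprD addrACA mulrDr.
apply: young_integral_add => //.
- by apply: measurable_funM => //; exact: measurable_funB.
- by apply: measurable_funM => //; exact: measurable_funB.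
- by under eq_integral do rewrite mulrA.
- by under eq_integral do rewrite mulrA.
Qed.

Lemma modular_approximableZ a f : modular_approximable f ->
  modular_approximable (fun x => a * f x).
Proof.
move=> [mf apf]; split; first exact: measurable_funM.
move=> c delta /(apf (c * a)); apply: filterS => n [h mh hf].
exists (fun x => a * h x); first exact: measurable_funM.
by under eq_integral do rewrite -mulrBr mulrA.
Qed.

(** Splits [f - h] as [(f - g) + (g - h)], with [h] an approximant of [g]. *)
Lemma modular_approximable_closure f : measurable_fun setT f ->
  (forall c delta : R, 0 < delta -> exists2 g, modular_approximable g &
    (\int[mu]_x (phi (c * (f x - g x)))%:E <= delta%:E)%E) ->
  modular_approximable f.
Proof.
move=> mf apf; split=> // c delta delta0.
have [g [mg apg] fg] := apf (2 * c) delta delta0.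
apply: filterS (apg (2 * c) delta delta0) => n [h mh gh]; exists h => //.
have mhT := measurable_wrtW (sA n) mh.
have -> : (fun x => (phi (c * (f x - h x)))%:E) =
    (fun x => (phi (c * (f x - g x) + c * (g x - h x)))%:E).
  by apply/funext => x; rewrite -mulrDr addrA subrK.
apply: young_integral_add => //.
- by apply: measurable_funM => //; exact: measurable_funB.
- by apply: measurable_funM => //; exact: measurable_funB.
- by under eq_integral do rewrite mulrA.
- by under eq_integral do rewrite mulrA.
Qed.

Variable D : set (set T).
Hypothesis sD : is_sub_sigma_algebra D.
Hypothesis AD : cvg_sigma mu A D.

Lemma modular_approximable_indic B : D B -> modular_approximable \1_B.
Proof.
move=> DB; have mB := sD.2 _ DB; split; first exact: measurable_indic.
move=> c delta delta0; have [A_ [AA_ cvgA]] := AD DB.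
have mA n : measurable (A_ n) by exact: (sA n).2.
(* The summand 1 allows division even when [c = 0]. *)
have phic0 : 0 < phi c + 1 by have := young_ge0 yphi c; lra.
move/fine_cvgP : cvgA => [finA /cvgrPdist_le/(_ (delta / (phi c + 1)))].
rewrite divr_gt0// => /(_ isT) cvgA.
apply: filterS2 finA cvgA => n finA; rewrite sub0r normrN => le_A.
exists (\1_(A_ n)).
  apply: measurable_indic; rewrite sub_sigma_algebra_measurableE//.
have mAB : measurable (A_ n `+` B) by apply: measurableU; exact: measurableD.
(* The two indicators differ by 1 or -1 exactly on the symmetric difference, and [phi] is even. *)
have E x : (phi (c * (\1_B x - \1_(A_ n) x)))%:E =
    ((phi c)%:E * (\1_(A_ n `+` B) x)%:E)%E.
  rewrite -EFinM !indicE; congr (_%:E).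
  rewrite [in RHS](_ : (x \in A_ n `+` B) = (x \in A_ n) (+) (x \in B)); last first.
    by rewrite in_setU !in_setD; case: (x \in A_ n); case: (x \in B).
  case: (x \in B); case: (x \in A_ n) => /=;
  rewrite ?subrr ?subr0 ?sub0r ?mulr0 ?mulr1 ?mulrN1 ?(young0 yphi)//;
  by rewrite (young_even yphi).
under eq_integral do rewrite E.
rewrite ge0_integralZl_EFin//; last 2 first.
- exact/measurable_EFinP/measurable_indic.
- exact: young_ge0.
rewrite integral_indic// setIT -(fineK finA) -EFinM lee_fin.
have := young_ge0 yphi c.
have h : fine (mu (A_ n `+` B)) <= delta / (phi c + 1).
  by apply: le_trans le_A; exact: ler_norm.
rewrite ler_pdivlMr// in h.
have : 0 <= fine (mu (A_ n `+` B)) by exact: fine_ge0.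
by move: h; rewrite mulrC; nra.
Qed.

(** A simple function is a finite combination of indicators of its level sets, which lie in [D]; the
    induction runs over the list of values. *)
Lemma modular_approximable_nnsfun (s : {nnsfun (g_sigma_algebraType D) >-> R}) :
  modular_approximable (s : g_sigma_algebraType D -> R).
Proof.
have -> : (s : g_sigma_algebraType D -> R) = (fun x =>
    \sum_(y <- finmap.enum_fset (fset_set (range s)))
      y * \1_(s @^-1` [set y]) x).
  by apply/funext => x; rewrite fimfunE fsbig_finite.
elim: (finmap.enum_fset _) => [|y r IH].
  under [X in modular_approximable X]eq_fun do rewrite big_nil.
  exact: modular_approximable_cst0.
under [X in modular_approximable X]eq_fun do rewrite big_cons.
apply: modular_approximableD IH; apply: modular_approximableZ.
apply: modular_approximable_indic; apply: (measurable_wrt_preimage sD) => //.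
exact: measurable_funP.
Qed.

(** For simple functions [s n] increasing to [f], the modular of [f - s n] tends to 0 by dominated
    convergence, with dominating function [phi (c * f x)]. *)
Lemma modular_approximable_ge0 f : measurable_wrt D f -> (forall x, 0 <= f x) ->
  (forall c, \int[mu]_x (phi (c * f x))%:E < +oo)%E -> modular_approximable f.
Proof.
move=> mf f0 fy; have mfT := measurable_wrtW sD mf.
apply: modular_approximable_closure => // c delta delta0.
have mfE : measurable_fun setT (EFin \o f : g_sigma_algebraType D -> \bar R).
  exact/measurable_EFinP.
have fE0 x : setT x -> (0 <= (EFin \o f) x)%E by rewrite lee_fin.
pose s_ n : {nnsfun (g_sigma_algebraType D) >-> R} := nnsfun_approx measurableT mfE n.
pose s n : T -> R := (s_ n : g_sigma_algebraType D -> R).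
have s0 n x : 0 <= s n x by exact: (@fun_ge0 _ _ (s_ n)).
have sf n x : s n x <= f x.
  by rewrite -lee_fin /s/s_ nnsfun_approxE; exact: le_approx.
have ms n : measurable_fun setT (s n).
  by apply: (measurable_wrtW sD); exact: measurable_funP.
have scvg x : s n x @[n --> \oo] --> f x.
  by have /fine_cvgP[_] := cvg_nnsfun_approx measurableT mfE fE0 (I : setT x).
have cM (u : T -> R) : measurable_fun setT u -> measurable_fun setT (fun x => c * u x).
  by move=> mu_; exact: measurable_funM.
have dom : (\int[mu]_x (phi (c * (f x - s n x)))%:E)%E @[n --> \oo] --> 0%E.
  have phicvg : {ae mu, forall x, setT x ->
      (phi (c * (f x - s n x)))%:E @[n --> \oo] --> (cst 0%E : T -> \bar R) x}.
    apply: aeW => x _; apply: cvg_EFin; first exact: nearW.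
    (* The limit 0 is rewritten as [phi (c * (f x - f x))] so that continuity of [phi] applies. *)
    rewrite /= -(young0 yphi) -(mulr0 c) -(subrr (f x)).
    apply: continuous_cvg; first exact: young_continuous.
    by apply: cvgMr; apply: cvgB => //; exact: cvg_cst.
  have phile : {ae mu, forall x n, setT x ->
      (`|(phi (c * (f x - s n x)))%:E| <= (phi (c * f x))%:E)%E}.
    apply: aeW => x n _; rewrite gee0_abs ?lee_fin ?young_ge0//.
    apply: young_le_norm => //; rewrite !normrM ler_wpM2l//.
    by rewrite !ger0_norm ?subr_ge0// gerBl.
  have [_ _] := dominated_convergence measurableT
    (fun n => measurable_young_comp yphi (cM _ (measurable_funB mfT (ms n))))
    (measurable_cst _) phicvg (young_integrable yphi (cM _ mfT) (fy c)) phile.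
  by rewrite integral_cst// mul0e.
move/fine_cvgP : dom => [fin /cvgrPdist_le/(_ _ delta0) le_delta].
near \oo => n; exists (s n); first exact: modular_approximable_nnsfun.
rewrite -(@fineK _ (\int[mu]_x _)%E); last by near: n.
rewrite lee_fin; apply: le_trans (ler_norm _) _.
by rewrite -normrN -sub0r; near: n.
Unshelve. all: by end_near.
Qed.

Lemma modular_approximable_Delta2 f : Delta2 phi -> orlicz_space mu phi D f ->
  modular_approximable f.
Proof.
move=> d2 [mf [a a0 fy]].
have mfT := measurable_wrtW sD mf.
have fcy := Delta2_modular_lty yphi d2 a0 mfT fy.
have fpm x : f x = (f^\+ \+ (fun x => -1 * f^\- x)) x.
  by rewrite /= mulN1r -[in LHS](funrposBneg f).
rewrite (funext fpm).
apply: modular_approximableD; last apply: modular_approximableZ.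
- apply: modular_approximable_ge0 => //; first exact: measurable_funrpos.
  move=> c; apply: le_lt_trans (fcy c); apply: young_integral_le => //.
  + by apply: measurable_funM => //; exact: measurable_funrpos.
  + exact: measurable_funM.
  + move=> x; rewrite !normrM ler_wpM2l// ger0_norm ?funrpos_ge0// /funrpos.
    by rewrite ge_max ler_norm normr_ge0.
- apply: modular_approximable_ge0 => //; first exact: measurable_funrneg.
  move=> c; apply: le_lt_trans (fcy c); apply: young_integral_le => //.
  + by apply: measurable_funM => //; exact: measurable_funrneg.
  + exact: measurable_funM.
  + move=> x; rewrite !normrM ler_wpM2l// ger0_norm ?funrneg_ge0// /funrneg.
    by rewrite ge_max -normrN ler_norm normr_ge0.
Qed.

End approximation.

(** * Luxemburg norm convergence, expressed through modulars and applied to both directions *)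

Section orlicz_convergence.
Context d (T : measurableType d) (R : realType).
Variables (mu : {finite_measure set T -> \bar R}) (phi : R -> R).
Hypothesis yphi : young_function phi.
Implicit Types f g h : T -> R.

Lemma is_sub_sigma_algebra_measurable :
  is_sub_sigma_algebra (measurable : set (set T)).
Proof. by split => //; exact: sigma_algebra_measurable. Qed.

Lemma measurable_wrt_measurable f :
  measurable_fun setT f -> measurable_wrt measurable f.
Proof.
move=> mf _ Y mY.
rewrite (sub_sigma_algebra_measurableE is_sub_sigma_algebra_measurable).
exact: mf.
Qed.

Lemma orlicz_space_integrable G f : is_sub_sigma_algebra G ->
  orlicz_space mu phi G f -> mu.-integrable setT (EFin \o f).
Proof.
move=> sG [mf [a a0 fy]].
exact: (modular_integrable yphi a0 (measurable_wrtW sG mf) fy).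
Qed.

Lemma young_cond_jensen G f k (c : R) : is_sub_sigma_algebra G ->
  mu.-integrable setT (EFin \o f) -> is_cond_exp mu G f k ->
  (\int[mu]_x (phi (c * k x))%:E <= \int[mu]_x (phi (c * f x))%:E)%E.
Proof.
move=> sG; apply: (@cond_jensen _ _ _ _ _ sG (fun x => phi (c * x))).
- exact: young_convex_ineqM.
- exact: young_continuousM.
- by move=> x; exact: young_ge0.
Qed.

Lemma orlicz_space_cond_exp G H f k : is_sub_sigma_algebra G ->
  is_sub_sigma_algebra H -> orlicz_space mu phi H f -> is_cond_exp mu G f k ->
  orlicz_space mu phi G k.
Proof.
move=> sG sH fH fk; have fi := orlicz_space_integrable sH fH.
case: fH => [_ [a a0 fy]]; split; first exact: fk.1.
by exists a => //; apply: le_lt_trans fy; exact: (young_cond_jensen _ sG).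
Qed.

(** Lets the chosen version of E(f | D), only a.e. equal to [f], replace [f] under the conditional
    expectations. *)
Lemma is_cond_exp_ae_eql G f g k : is_sub_sigma_algebra G ->
  measurable_fun setT f -> measurable_fun setT g ->
  {ae mu, forall x, f x = g x} -> is_cond_exp mu G f k -> is_cond_exp mu G g k.
Proof.
move=> sG mf mg fg [mk fk]; split=> // B GB; rewrite -fk//.
apply: ae_eq_integral; first exact: sG.2.
- exact/measurable_EFinP/measurable_funTS.
- exact/measurable_EFinP/measurable_funTS.
- by apply: filterS fg => x /= -> _.
Qed.

Lemma cond_exp_id G f : is_sub_sigma_algebra G -> measurable_wrt G f ->
  mu.-integrable setT (EFin \o f) -> {ae mu, forall x, cond_exp mu G f x = f x}.
Proof.
move=> sG mf fi; apply: (is_cond_exp_ae_eq sG fi); last by split.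
exact: cond_expP.
Qed.

Lemma luxemburg_norm_ae_eq f g : measurable_fun setT f -> measurable_fun setT g ->
  {ae mu, forall x, f x = g x} ->
  luxemburg_norm mu phi f = luxemburg_norm mu phi g.
Proof.
move=> mf mg fg; rewrite /luxemburg_norm; congr (ereal_inf [set _ | _ in _]).
apply/funext => k; congr (_ /\ (_ <= _)%E).
apply: ae_eq_integral => //.
- apply: measurable_young_comp => //; apply: measurable_funM => //.
  exact: measurableT_comp.
- apply: measurable_young_comp => //; apply: measurable_funM => //.
  exact: measurableT_comp.
- by apply: filterS fg => x /= -> _.
Qed.

(** A norm below [c^-1] provides an admissible [k < c^-1], and the modular is monotone; conversely,
    modular at most 1 for [c = e^-1] makes [k = e] admissible. *)
Lemma luxemburg_norm_cvg0P (u : nat -> T -> R) :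
  (forall n, measurable_fun setT (u n)) ->
  luxemburg_norm mu phi (u n) @[n --> \oo] --> 0%E <->
  (forall c : R, 0 < c ->
    \forall n \near \oo, (\int[mu]_x (phi (c * u n x))%:E <= 1)%E).
Proof.
move=> mf.
have E n k : 0 < k -> (\int[mu]_x (phi (`|u n x| / k))%:E)%E =
    (\int[mu]_x (phi (k^-1 * u n x))%:E)%E.
  move=> k0; apply: eq_integral => x _; congr (_%:E).
  by rewrite -(young_norm yphi (k^-1 * _)) normrM gtr0_norm ?invr_gt0// mulrC.
have lux_ge0 n : (0 <= luxemburg_norm mu phi (u n))%E.
  by apply: le_ereal_inf_tmp => _ [k [k0 _] <-]; rewrite lee_fin ltW.
split=> [/fine_cvgP[fin /cvgrPdist_lt cvg0] c c0|le1].
- have cV0 : 0 < c^-1 by rewrite invr_gt0.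
  apply: filterS2 fin (cvg0 _ cV0) => n fin.
  rewrite sub0r normrN ger0_norm ?fine_ge0// -lte_fin fineK//.
  move=> /ereal_inf_lt[_ [k [k0 kle1] <-]]; rewrite lte_fin => kc.
  rewrite E// in kle1; apply: le_trans kle1; apply: young_integral_le => //.
  + exact: measurable_funM.
  + exact: measurable_funM.
  + move=> x; rewrite !normrM ler_wpM2r// !gtr0_norm ?invr_gt0//.
    by rewrite -[leLHS]invrK lef_pV2 ?posrE// ltW.
- have lux_le e : 0 < e -> \forall n \near \oo, (luxemburg_norm mu phi (u n) <= e%:E)%E.
    move=> e0; have eV0 : 0 < e^-1 by rewrite invr_gt0.
    apply: filterS (le1 _ eV0) => n ule1.
    by apply: ereal_inf_lbound; exists e => //; split=> //; rewrite E.
  (* The norm is extended-real valued, so it must first be shown to be eventually finite. *)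
  apply/fine_cvgP; split.
    apply: filterS (lux_le _ ltr01) => n lux1.
    by rewrite ge0_fin_numE//; apply: le_lt_trans lux1 _; rewrite ltry.
  apply/cvgrPdist_le => e e0; apply: filterS (lux_le _ e0) => n luxe.
  rewrite sub0r normrN ger0_norm ?fine_ge0// -lee_fin fineK//.
  by rewrite ge0_fin_numE//; apply: le_lt_trans luxe _; rewrite ltry.
Qed.

Lemma orlicz_cvg_cond_exp (A : nat -> set (set T)) (D : set (set T))
    f (k : nat -> T -> R) :
  (forall n, is_sub_sigma_algebra (A n)) -> is_sub_sigma_algebra D ->
  cvg_sigma mu A D -> Delta2 phi -> orlicz_space mu phi D f ->
  (forall n, is_cond_exp mu (A n) f (k n)) ->
  luxemburg_norm mu phi (k n \- f) @[n --> \oo] --> 0%E.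
Proof.
move=> sA sD AD d2 fD fk; have fi := orlicz_space_integrable sD fD.
have [mf apf] := modular_approximable_Delta2 yphi sA sD AD d2 fD.
have mk n : measurable_fun setT (k n) by exact: measurable_wrtW (fk n).1.
apply/luxemburg_norm_cvg0P => [n|c c0]; first exact: measurable_funB.
have c20 : 0 < 2 * c by lra.
(* The factor 2 pays for [young_integral_add]; the bound 1 is what the norm criterion asks for. *)
apply: filterS (apf (2 * c) 1 ltr01) => n [h mh fh].
have mhT := measurable_wrtW (sA n) mh.
have fhi : mu.-integrable setT (EFin \o (f \- h)).
  apply: (modular_integrable yphi c20); first exact: measurable_funB.
  by apply: le_lt_trans fh _; rewrite ltry.
(* Approximants come without integrability; it is recovered from [h = f - (f - h)]. *)
have hi : mu.-integrable setT (EFin \o h).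
  have -> : EFin \o h = (fun x => (f x)%:E - (f x - h x)%:E)%E.
    by apply/funext => x; rewrite -EFinB/=; congr (_%:E); ring.
  exact: integrableB.
have khP := is_cond_expB (sA n) fi hi mh (fk n).
have -> : (fun x => (phi (c * (k n \- f) x))%:E) =
    (fun x => (phi (c * (k n x - h x) + c * (h x - f x)))%:E).
  by apply/funext => x; rewrite -mulrDr addrA subrK.
apply: young_integral_add => //.
- by apply: measurable_funM => //; exact: measurable_funB.
- by apply: measurable_funM => //; exact: measurable_funB.
- apply: le_trans fh; under eq_integral do rewrite mulrA.
  exact: (young_cond_jensen _ (sA n) fhi khP).
- apply: le_trans fh; apply: young_integral_le => //.
  + by do 2 apply: measurable_funM => //; exact: measurable_funB.
  + by apply: measurable_funM => //; exact: measurable_funB.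
  + by move=> x; rewrite !mulrA !normrM distrC.
Qed.

Lemma cvg_sigma_orlicz (A : nat -> set (set T)) B (k : nat -> T -> R) :
  (forall n, is_sub_sigma_algebra (A n)) -> measurable B ->
  (forall n, measurable_wrt (A n) (k n)) ->
  luxemburg_norm mu phi (k n \- \1_B) @[n --> \oo] --> 0%E ->
  mu ((k n @^-1` `]2^-1, +oo[) `+` B) @[n --> \oo] --> 0%E.
Proof.
move=> sA mB mkA; have mk n := measurable_wrtW (sA n) (mkA n).
have mkB n : measurable_fun setT (k n \- \1_B) by exact: measurable_funB.
move=> /(luxemburg_norm_cvg0P mkB) cvg0.
pose C n := (k n @^-1` `]2^-1, +oo[) `+` B.
have mC n : measurable (C n).
  suff mkn : measurable (k n @^-1` `]2^-1, +oo[).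
    by apply: measurableU; exact: measurableD.
  by rewrite -[X in measurable X]setTI; exact: mk.
apply/fine_cvgP; split; first by apply: nearW => n; exact: fin_num_measure (mC n).
apply/cvgrPdist_le => e e0.
(* The dilation [c] is chosen with [phi (c / 2) >= e^-1]; Chebyshev's bound
   [phi (c / 2) * mu (C n) <= 1] then gives [mu (C n) <= e]. *)
have [M [_ phiM]] := (cvgryPge _).1 (young_cvgy yphi) e^-1.
pose c := 2 * (`|M| + 1).
have Mc : M < c / 2 by rewrite /c mulrAC divff ?mul1r// ltr_pwDr// ler_norm.
have c0 : 0 < c by rewrite mulr_gt0// ltr_wpDl.
have phic0 : 0 < phi (c / 2) by rewrite (lt_le_trans _ (phiM _ Mc))// invr_gt0.
apply: filterS (cvg0 c c0) => n kle1.
rewrite sub0r normrN ger0_norm ?fine_ge0//.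
have : ((phi (c / 2))%:E * mu (C n) <= 1)%E.
  apply: le_trans kle1; rewrite -(setIT (C n)) -integral_indic//.
  rewrite -ge0_integralZl_EFin//; last 2 first.
  - exact/measurable_EFinP/measurable_indic.
  - exact: ltW.
  apply: ge0_le_integral => //.
  - by move=> x _; rewrite mule_ge0// lee_fin ltW.
  - by apply: measurable_funeM; exact/measurable_EFinP/measurable_indic.
  - by apply: measurable_young_comp => //; exact: measurable_funM.
  - move=> x _; rewrite -EFinM lee_fin indicE.
    have [Cx|_] := boolP (x \in C n); last by rewrite mulr0 young_ge0.
    rewrite mulr1; apply: young_le_norm => //.
    rewrite !normrM ler_wpM2l// gtr0_norm ?invr_gt0//=.
    (* On [C n], either [k n > 1/2] off [B] or [k n <= 1/2] on [B]; both put [k n] at distance at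
       least 1/2 from the indicator. *)
    move: Cx; rewrite /C inE => -[[/=]|[Bx /=]]; rewrite in_itv/= andbT indicE.
    + by move=> kx Bx; rewrite memNset// subr0 (le_trans (ltW kx))// ler_norm.
    + rewrite mem_set//= => /negP; rewrite -leNgt => kx.
      by rewrite distrC (le_trans _ (ler_norm _))//; lra.
rewrite -(fineK (fin_num_measure mu _ (mC n))) -EFinM lee_fin => le1.
have m0 : 0 <= fine (mu (C n)) by exact: fine_ge0.
rewrite -[leRHS]mulr1 -ler_pdivrMl//; apply: le_trans le1.
by rewrite ler_wpM2r// phiM.
Qed.

End orlicz_convergence.

Theorem theorem2p6 (R : realType) (d : measure_display) (T : measurableType d)
    (mu : {finite_measure set T -> \bar R}) (phi : R -> R)
    (A : nat -> set (set T)) (D : set (set T)) :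
  measure_is_complete mu ->
  young_function phi ->
  (forall n, is_sub_sigma_algebra (A n)) ->
  is_sub_sigma_algebra D ->
  (cvg_sigma mu A D -> Delta2 phi ->
     forall f, orlicz_space mu phi D f ->
       orlicz_cvg mu phi (fun n => cond_exp mu (A n) f) (cond_exp mu D f) /\
       {ae mu, forall x, cond_exp mu D f x = f x})
  /\
  ((forall f, orlicz_space mu phi D f ->
       orlicz_cvg mu phi (fun n => cond_exp mu (A n) f) (cond_exp mu D f) /\
       {ae mu, forall x, cond_exp mu D f x = f x}) ->
   cvg_sigma mu A D).
Proof.
move=> _ yphi sA sD; split=> [AD d2 f fD|cvgE B DB].
- have fi := orlicz_space_integrable yphi sD fD.
  have mf := measurable_wrtW sD fD.1.
  have gf := cond_exp_id sD fD.1 fi.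
  have fg := cond_expP sD fi.
  have mg := measurable_wrtW sD fg.1.
  have gD := orlicz_space_cond_exp yphi sD sD fD fg.
  have fk n := cond_expP (sA n) fi.
  have widen G h : is_sub_sigma_algebra G -> orlicz_space mu phi G h ->
      orlicz_space mu phi measurable h.
    move=> sG [mh hy]; split=> //.
    exact: measurable_wrt_measurable (measurable_wrtW sG mh).
  split=> //; split.
  + move=> n; apply: (widen (A n)) => //.
    exact: (orlicz_space_cond_exp yphi (sA n) sD fD (fk n)).
  + exact: (widen D).
  (* The limit is the chosen version of E(f | D), so the convergence result is applied to that
     version, itself in L^phi(D), instead of to [f]. *)
  + apply: (orlicz_cvg_cond_exp yphi sA sD AD d2 gD) => n.
    by apply: (is_cond_exp_ae_eql (sA n) mf mg) => //; apply: filterS gf => x ->.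
- have mB := sD.2 _ DB.
  have m1 : measurable_wrt D (\1_B : T -> R).
    by apply: measurable_indic; rewrite sub_sigma_algebra_measurableE.
  have fD : orlicz_space mu phi D (\1_B : T -> R).
    split=> //; exists 1 => //.
    apply: (@le_lt_trans _ _ (\int[mu]_x (phi 1)%:E)%E).
      apply: young_integral_le => //; first exact: measurable_funM.
      by move=> x; rewrite mul1r indicE; case: (_ \in _); rewrite ?normr1 ?normr0.
    rewrite integral_cst// ltey_eq fin_numM// fin_num_measure//.
  have [[_ _ cvg0] gB] := cvgE _ fD.
  have fi := orlicz_space_integrable yphi sD fD.
  have fk n := cond_expP (sA n) fi.
  have fg := cond_expP sD fi.
  exists (fun n => cond_exp mu (A n) \1_B @^-1` `]2^-1, +oo[); split.
    by move=> n; apply: (measurable_wrt_preimage (sA n) (fk n).1).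
  apply: (cvg_sigma_orlicz yphi sA mB (fun n => (fk n).1)).
  (* The hypothesis gives convergence to the chosen version of E(1_B | D); a.e. equality with the
     indicator leaves the norms unchanged. *)
  under eq_fun => n.
    rewrite (@luxemburg_norm_ae_eq _ _ _ mu phi yphi _
      (cond_exp mu (A n) \1_B \- cond_exp mu D \1_B)).
  over.
  - exact: measurable_funB (measurable_wrtW (sA n) (fk n).1) _.
  - exact: measurable_funB (measurable_wrtW (sA n) (fk n).1) (measurable_wrtW sD fg.1).
  - by apply: filterS gB => x /= ->.
  exact: cvg0.
Qed.
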